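(* Let $\mathcal F=\{f_1,\ldots,f_n\}$ be a fraction with $n\ge 2$ runs of the full factorial design $\mathcal D=\mathcal D_1\times\cdots\times\mathcal D_m$, let $R^{(f_i)}=\sum_{\alpha\in L}c_\alpha^{(f_i)}X^\alpha$ be the indicator function of the point $f_i$, let $f\in\mathcal F$ be one of the runs, and let $\mathcal F_f$ be the fraction with $n-1$ runs obtained by removing the run $f$ from $\mathcal F$. Then for every $j=0,\ldots,m$, $$A_j(\mathcal F)=\left(\frac{n-1}{n}\right)^2A_j(\mathcal F_f)+\frac{1}{n^2}A_j(f)+\frac{2(\#\mathcal D)^2}{n^2}\sum_{g\in\mathcal F,\ g\neq f}\ \sum_{|\alpha|_0=j}c_\alpha^{(f)}\,\overline{c_\alpha^{(g)}},$$ where the sum over $g\in\mathcal F$, $g\ne f$, is over the $n-1$ runs of $\mathcal F_f$ (counted with multiplicity).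
   Context: Full factorial design: for $i=1,\ldots,m$ the $s_i$ levels of the $i$-th factor are coded by the $s_i$-th roots of unity, $\mathcal D_i=\{\omega_0^{(s_i)},\ldots,\omega_{s_i-1}^{(s_i)}\}$ with $\omega_k^{(s_i)}=\exp(\sqrt{-1}\,2\pi k/s_i)$, and $\mathcal D=\mathcal D_1\times\cdots\times\mathcal D_m$, with $\#\mathcal D=\prod_{i=1}^m s_i$. A fraction $\mathcal F$ is a (finite) multiset whose elements (runs) lie in $\mathcal D$ (replicates are allowed); its size $n=\#\mathcal F$ is the number of its points counted with multiplicity, and $\mathcal F=\{f_1,\ldots,f_n\}$ lists the points with multiplicity. A single point $f\in\mathcal D$ is regarded as a fraction of size $1$. Let $L=\mathbb Z_{s_1}\times\cdots\times\mathbb Z_{s_m}$ and, for $\alpha\in L$ and $\zeta=(\zeta_1,\ldots,\zeta_m)\in\mathcal D$, let $X^\alpha(\zeta)=\zeta_1^{\alpha_1}\cdots\zeta_m^{\alpha_m}$. The functions $X^\alpha$, $\alpha\in L$, form a basis of the complex functions on $\mathcal D$. The counting function $R:\mathcal D\to\mathbb C$ of $\mathcal F$ is the function whose value $R(\zeta)$ is the number of appearances of $\zeta$ in $\mathcal F$; its coefficients $c_\alpha\in\mathbb C$ are defined by $R=\sum_{\alpha\in L}c_\alpha X^\alpha$. The counting function of a single point $f$ is its indicator function $R^{(f)}$ (equal to $1$ at $f$ and $0$ elsewhere on $\mathcal D$), with coefficients denoted $c_\alpha^{(f)}$. Let $|\alpha|_0$ be the number of non-zero components of $\alpha$. The Generalized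 Word-Length Pattern (GWLP) of $\mathcal F$ is the vector $(A_0(\mathcal F),\ldots,A_m(\mathcal F))$ with $$A_j(\mathcal F)=\sum_{|\alpha|_0=j}\left(\frac{|c_\alpha|}{c_0}\right)^2,\qquad c_0=c_{(0,\ldots,0)}=\frac{n}{\#\mathcal D},$$ where $|c_\alpha|$ is the modulus of $c_\alpha$. *)

(* Defs.v *)
From mathcomp Require Import all_boot all_order all_algebra.
From mathcomp Require Import finmap multiset complex.
From mathcomp Require Import reals trigo ring lra.

Set Implicit Arguments.
Unset Strict Implicit.
Unset Printing Implicit Defensive.

Import Order.TTheory GRing.Theory Num.Theory.

Local Open Scope ring_scope.
Local Open Scope mset_scope.

Section FactorialDesign.
Variable R : realType.

(* exp(sqrt(-1) t), by Euler's formula. *)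
Definition expi (t : R) : R[i] := Complex (cos t) (sin t).

Definition omega (s k : nat) : R[i] := expi (2 * pi * k%:R / s%:R).

Definition levels (s : nat) : seq R[i] := [seq omega s k | k <- iota 0 s].

Variables (m : nat) (s : 'I_m -> nat).

Definition design : Type := {dffun forall i : 'I_m, seq_sub (levels (s i))}.

(* 'I_(n.-1.+1) carries the additive group Z/n for every n > 0, whereas 'Z_1  *)
(* would have two elements.                                                   *)
Definition exponents : Type := {dffun forall i : 'I_m, 'I_(s i).-1.+1}.

Definition exponent0 : exponents := [ffun i => 0].

Definition wt0 (a : exponents) : nat := #|[set i | a i != 0]|.

Definition monomial (a : exponents) : {ffun design -> R[i]^o} :=
  [ffun z : design => \prod_(i < m) ssval (z i) ^+ a i].

Definition monomials : #|{: exponents}|.-tuple {ffun design -> R[i]^o} :=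
  [tuple monomial (enum_val k) | k < #|{: exponents}|].

Definition counting (F : {mset design}) : {ffun design -> R[i]^o} :=
  [ffun z => (F z)%:R].

(* c_alpha; see monomials_basis and counting_coef below. *)
Definition coef (F : {mset design}) (a : exponents) : R[i] :=
  coord monomials (enum_rank a) (counting F).

(* The values are real numbers, seen in R[i]. *)
Definition gwlp (F : {mset design}) (j : nat) : R[i] :=
  \sum_(a : exponents | wt0 a == j) (`|coef F a| / coef F exponent0) ^+ 2.

End FactorialDesign.

Section Basis.
Variable R : realType.

Lemma expiD (t u : R) : expi (t + u) = expi t * expi u.
Proof.
by rewrite /expi cosD sinD; apply/eqP; rewrite eq_complex /= eqxx addrC /= eqxx.
Qed.

Lemma expi0 : expi (0 : R) = 1.
Proof. by rewrite /expi cos0 sin0. Qed.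

Lemma expiMn (t : R) k : expi (t * k%:R) = expi t ^+ k.
Proof.
elim: k => [|k IHk]; first by rewrite mulr0 expi0.
by rewrite -addn1 natrD mulrDr mulr1 expiD IHk exprD.
Qed.

Lemma omega_exp s k : omega R s k = omega R s 1 ^+ k.
Proof.
by rewrite /omega -expiMn mulr1; congr expi; rewrite -!mulrA (mulrC k%:R).
Qed.

Lemma omega1_unity s : (0 < s)%N -> omega R s 1 ^+ s = 1.
Proof.
move=> s_gt0; rewrite /omega -expiMn mulr1 divfK ?pnatr_eq0 -?lt0n //.
by rewrite /expi mulrC mulr_natr cos2pi sin2pi.
Qed.

Lemma omega_neq1 s k : (0 < k < s)%N -> omega R s k != 1.
Proof.
move=> /andP[k_gt0 lt_ks]; apply/eqP => /(congr1 (@complex.Re R)) /=.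
have s_gt0 : (0 < s)%N by exact: ltn_trans lt_ks.
have sinp : 0 < sin (pi * k%:R / s%:R : R).
  apply: sin_gt0_pi; rewrite divr_gt0 ?mulr_gt0 ?pi_gt0 ?ltr0n //=.
  by rewrite ltr_pdivrMr ?ltr0n // ltr_pM2l ?pi_gt0 // ltr_nat.
have -> : 2 * pi * k%:R / s%:R = (pi * k%:R / s%:R) *+ 2 :> R.
  by rewrite -[RHS]mulr_natl !mulrA.
rewrite cos_mulr2n cos2sin2 mulrnBl => cosE.
have : sin (pi * k%:R / s%:R : R) ^+ 2 = 0.
  by move: cosE; set u := _ ^+ 2 => cosE; lra.
by apply/eqP; rewrite expf_eq0 /= gt_eqF.
Qed.

Lemma omega_inj s k l : (k < s)%N -> (l < s)%N ->
  omega R s k = omega R s l -> k = l.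
Proof.
wlog le_kl : k l / (k <= l)%N => [IH ks ls kl|].
  by have [/IH|/ltnW/IH] := leqP k l; [apply | move=> h; apply/esym/h].
move=> ks ls; rewrite -(subnK le_kl) [RHS]omega_exp [LHS]omega_exp exprD.
have s_gt0 : (0 < s)%N by apply: leq_ltn_trans ks.
have w_neq0 : omega R s 1 != 0.
  by apply: contra_eq_neq (omega1_unity s_gt0) => ->; rewrite expr0n gtn_eqF // eq_sym oner_eq0.
rewrite -[LHS]mul1r => /(mulIf (expf_neq0 _ w_neq0))/esym.
rewrite -omega_exp; have [->//|d_gt0] := posnP (l - k).
by move/eqP/negPn; rewrite omega_neq1 // d_gt0 (leq_ltn_trans (leq_subr _ _)).
Qed.

Lemma uniq_levels s : uniq (levels R s).
Proof.
rewrite map_inj_in_uniq ?iota_uniq // => k l; rewrite !mem_iota !add0n.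
exact: omega_inj.
Qed.

Lemma levels_unity s (z : R[i]) : (0 < s)%N -> z \in levels R s -> z ^+ s = 1.
Proof.
move=> s_gt0 /mapP[k _ ->].
by rewrite omega_exp -exprM mulnC exprM omega1_unity // expr1n.
Qed.

Variables (m : nat) (s : 'I_m -> nat).
Hypothesis s_gt0 : forall i, (0 < s i)%N.

Lemma card_design : #|{: design R s}| = (\prod_(i < m) s i)%N.
Proof.
rewrite card_dep_ffun foldrE big_image; apply: eq_bigr => i _.
by rewrite card_seq_sub ?uniq_levels // size_map size_iota.
Qed.

Lemma card_exponents : #|{: exponents s}| = (\prod_(i < m) s i)%N.
Proof.
rewrite card_dep_ffun foldrE big_image; apply: eq_bigr => i _.
by rewrite card_ord prednK.
Qed.

Lemma sum_expr_eq0 k (z : R[i]) : z ^+ k = 1 -> z != 1 ->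
  \sum_(l < k) z ^+ l = 0.
Proof.
move=> zk1 z_neq1; have := subrX1 z k; rewrite zk1 subrr => /esym/eqP.
by rewrite mulf_eq0 subr_eq0 (negPf z_neq1) => /eqP.
Qed.

Lemma prod_sum_exponents (x : 'I_m -> R[i]) :
  \sum_(a : exponents s) \prod_(i < m) x i ^+ a i
  = \prod_(i < m) \sum_(k < s i) x i ^+ k.
Proof.
pose N := \max_i s i.
have le_sN i : (s i <= N)%N by apply: leq_bigmax.
transitivity (\prod_(i < m) \sum_(k < N.+1 | (k < s i)%N) x i ^+ k); last first.
  by apply: eq_bigr => i _; rewrite (big_ord_widen _ (fun k => x i ^+ k) (leqW (le_sN i))).
rewrite bigA_distr_big_dep.
pose h (g : {ffun 'I_m -> 'I_N.+1}) : exponents s := [ffun i => inord (g i)].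
pose h' (a : exponents s) : {ffun 'I_m -> 'I_N.+1} := [ffun i => inord (a i)].
have lt_a (a : exponents s) i : (a i < s i)%N.
  by rewrite (leq_trans (ltn_ord _)) ?prednK.
have lt_aN (a : exponents s) i : (a i < N.+1)%N.
  by rewrite ltnS (leq_trans (ltnW (lt_a a i))).
rewrite [RHS](reindex h') /=; last first.
  exists h => [a _|g /familyP gs]; apply/ffunP => i; rewrite !ffunE.
    by rewrite [X in inord X]inordK ?inord_val.
  have lt_g : (g i < s i)%N by exact: gs.
  by apply/val_inj; rewrite /= inordK /= inordK ?prednK.
apply: eq_big => [a|a _].
  by apply/esym/familyP => i; rewrite unfold_in ffunE inordK.
by apply: eq_bigr => i _; rewrite ffunE inordK.
Qed.

Lemma sum_monomial (z w : design R s) :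
  \sum_a (monomial R a w)^-1 * monomial R a z = (#|{: design R s}| * (z == w))%:R.
Proof.
pose x i := ssval (z i) / ssval (w i).
have w_neq0 i : ssval (w i) != 0.
  apply: contra_eq_neq (levels_unity (s_gt0 i) (ssvalP (w i))) => ->.
  by rewrite expr0n gtn_eqF // eq_sym oner_eq0.
have monE a : (monomial R a w)^-1 * monomial R a z = \prod_(i < m) x i ^+ a i.
  rewrite !ffunE mulrC -[LHS]prodf_div.
  by apply: eq_bigr => i _; rewrite expr_div_n.
rewrite (eq_bigr _ (fun a _ => monE a)).
rewrite (prod_sum_exponents x) card_design natrM.
have [eq_zw|neq_zw] := eqVneq z w.
  rewrite mulr1 natr_prod; apply: eq_bigr => i _; rewrite /x eq_zw divff //.
  under eq_bigr => k _ do rewrite expr1n.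
  by rewrite sumr_const card_ord.
rewrite mulr0; apply/eqP/prodf_eq0.
have [i neq_zwi] : exists i, z i != w i.
  apply/existsP; apply: contra_neqT neq_zw; rewrite negb_exists => /forallP eq_zw.
  by apply/ffunP => i; apply/eqP; rewrite -[_ == _]negbK.
exists i => //; apply/eqP/sum_expr_eq0.
  rewrite expr_div_n (levels_unity (s_gt0 i) (ssvalP (z i))).
  by rewrite (levels_unity (s_gt0 i) (ssvalP (w i))) divr1.
apply: contra_neq neq_zwi => /(canRL (divfK (w_neq0 i))); rewrite mul1r.
exact: val_inj.
Qed.

Lemma monomials_basis : basis_of fullv (monomials R s).
Proof.
have dimE : \dim {: {ffun design R s -> R[i]^o}} = #|{: exponents s}|.
  by rewrite dimvf /dim /= /dim /= muln1 card_design card_exponents.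
rewrite basisEdim size_tuple dimE leqnn andbT; apply/subvP => g _.
have D_neq0 : (#|{: design R s}|%:R : R[i]) != 0.
  rewrite pnatr_eq0 card_design -lt0n.
  by apply: prodn_gt0.
pose c a := \sum_w g w / #|{: design R s}|%:R / monomial R a w : R[i].
have expand z : g z = \sum_a c a * monomial R a z :> R[i].
  under [RHS]eq_bigr => a _ do rewrite mulr_suml.
  rewrite exchange_big /=.
  have sumE w : \sum_a g w / #|{: design R s}|%:R / monomial R a w * monomial R a z
      = g w / #|{: design R s}|%:R * (#|{: design R s}| * (z == w))%:R :> R[i].
    rewrite -sum_monomial mulr_sumr.
    by apply: eq_bigr => a _; rewrite mulrA.
  rewrite (eq_bigr _ (fun w _ => sumE w)) (bigD1 z) //= big1 => [|w neq_wz].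
    by rewrite eqxx muln1 divfK ?addr0.
  by rewrite eq_sym (negPf neq_wz) muln0 mulr0.
have -> : g = \sum_a c a *: monomial R a.
  apply/ffunP => z; rewrite expand (sum_ffunE _ _ _ z).
  apply: eq_bigr => a _.
  by rewrite [RHS]ffunE.
apply: rpred_sum => a _; apply: rpredZ; apply: memv_span.
by apply/tnthP; exists (enum_rank a); rewrite tnth_mktuple enum_rankK.
Qed.

Lemma counting_coef (F : {mset design R s}) :
  counting F = \sum_a coef F a *: monomial R a.
Proof.
rewrite [LHS](coord_basis monomials_basis) ?memvf //.
rewrite [RHS](reindex (fun k : 'I_#|{: exponents s}| => enum_val k)) /=; last exact: onW_bij (@enum_val_bij _).
by apply: eq_bigr => k _; rewrite /coef enum_valK nth_mktuple.
Qed.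

End Basis.

(* Main.v *)
Require Import Defs.
From mathcomp Require Import all_boot all_order all_algebra.
From mathcomp Require Import finmap multiset complex reals.
From mathcomp Require Import ring.

Import GRing.Theory Num.Theory.
Local Open Scope ring_scope.
Local Open Scope mset_scope.

(** The coefficients of the counting function are additive in the fraction:
    splitting off the run f, each coefficient of F is the sum of those of the
    point f and of the remaining fraction.  Up to division by the square of the
    constant coefficient, the j-th entry of the word-length pattern is the
    squared Hermitian norm of the coefficients of weight j, so expanding
    |c + d|^2 = |c|^2 + |d|^2 + c * d^* + c^* * d produces the two pattern
    entries on the right-hand side, the prefactors coming from the constant
    coefficients n / #D, (n - 1) / #D and 1 / #D.

    What remains are two mutually conjugate cross terms, and the formula
    claims that they are equal.  This can fail exponent by exponent and holds
    after summation over the exponents of weight j: levels are roots of unity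
    and counting functions are real valued, so negating the exponent conjugates
    the coefficient ([coef_opp]) while preserving the weight.  The sum is thus
    invariant under conjugation ([coef_product_real]), and the cross terms add
    up to twice one of them.  Additivity again, over all runs of the remaining
    fraction, turns it into the double sum of the statement.

    Both the additivity over runs and the conjugation symmetry are read off the
    explicit formula [coefE] for the coefficients. *)

Lemma card_design_neq0 (R : realType) {m : nat} {s : 'I_m -> nat} :
  (forall i, (0 < s i)%N) -> #|{: design R s}|%:R != 0 :> R[i].
Proof.
by move=> s_gt0; rewrite pnatr_eq0 card_design -lt0n; apply: prodn_gt0.
Qed.

(** Fourier inversion on the finite abelian group formed by the design: by the
    orthogonality relations [sum_monomial], the coefficients on the right-hand
    side expand the counting function, and such an expansion is unique since
    the monomials are linearly independent. *)
Lemma coefE {R : realType} {m : nat} {s : 'I_m -> nat} :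
  (forall i, (0 < s i)%N) ->
  forall (F : {mset design R s}) (a : exponents s),
  coef F a = #|{: design R s}|%:R^-1 * \sum_(g <- F) (monomial R a g)^-1.
Proof.
move=> s_gt0 F a; have D_neq0 := card_design_neq0 R s_gt0.
pose c (b : exponents s) : R[i] :=
  #|{: design R s}|%:R^-1 * \sum_(g <- F) (monomial R b g)^-1.
have expand : counting F = \sum_b c b *: monomial R b.
  apply/ffunP => z; rewrite (sum_ffunE _ _ _ z) ffunE.
  under eq_bigr => b _ do rewrite ffunE /GRing.scale /= -mulrA mulr_suml.
  rewrite -mulr_sumr exchange_big /=.
  under eq_bigr => g _ do rewrite sum_monomial // natrM.
  rewrite -mulr_sumr mulKf // -count_mem_mset -sum1_count natr_sum big_mkcond /=.
  by apply: eq_bigr => g _; rewrite eq_sym; case: eqP.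
rewrite /coef expand (reindex (fun k : 'I_#|{: exponents s}| => enum_val k)) /=;
  last exact: onW_bij (@enum_val_bij _).
under eq_bigr => k _.
  rewrite (_ : monomial R (enum_val k) = (monomials R s)`_k); last by rewrite nth_mktuple.
  over.
by rewrite coord_sum_free ?enum_rankK // (basis_free (monomials_basis R s_gt0)).
Qed.

Lemma coefD {R : realType} {m : nat} {s : 'I_m -> nat}
    (A B : {mset design R s}) (a : exponents s) :
  coef (A `+` B) a = coef A a + coef B a.
Proof.
rewrite /coef -linearD; congr (coord _ _ _).
by apply/ffunP => z; rewrite !ffunE msetE2 natrD.
Qed.

Lemma coef_mset1 {R : realType} {m : nat} {s : 'I_m -> nat} :
  (forall i, (0 < s i)%N) ->
  forall (g : design R s) (a : exponents s),
  coef [mset g] a = #|{: design R s}|%:R^-1 * (monomial R a g)^-1.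
Proof.
move=> s_gt0 g a; rewrite coefE //; congr (_ * _).
have -> : [mset g] = seq_mset [:: g].
  by apply/msetP => z; rewrite msetnE mset_seqE /= addn0 eq_sym; case: eqP.
by rewrite (perm_big _ (perm_eq_seq_mset [:: g])) big_seq1.
Qed.

Lemma coef_sum {R : realType} {m : nat} {s : 'I_m -> nat} :
  (forall i, (0 < s i)%N) ->
  forall (F : {mset design R s}) (a : exponents s),
  coef F a = \sum_(g <- F) coef [mset g] a.
Proof.
move=> s_gt0 F a; rewrite coefE // mulr_sumr.
by apply: eq_bigr => g _; rewrite coef_mset1.
Qed.

Lemma coef_exponent0 {R : realType} {m : nat} {s : 'I_m -> nat} :
  (forall i, (0 < s i)%N) ->
  forall F : {mset design R s},
  coef F (exponent0 s) = (size F)%:R / #|{: design R s}|%:R.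
Proof.
move=> s_gt0 F; rewrite coefE // mulrC; congr (_ / _).
rewrite -sum1_size natr_sum; apply: eq_bigr => g _.
by rewrite ffunE big1 ?invr1 // => i _; rewrite ffunE.
Qed.

Definition opp_exponents {m : nat} {s : 'I_m -> nat} (a : exponents s) :
  exponents s := [ffun i => - a i].

Lemma opp_exponentsK {m : nat} {s : 'I_m -> nat} :
  involutive (@opp_exponents m s).
Proof. by move=> a; apply/ffunP => i; rewrite !ffunE opprK. Qed.

Lemma wt0_opp {m : nat} {s : 'I_m -> nat} (a : exponents s) :
  wt0 (opp_exponents a) = wt0 a.
Proof. by apply: eq_card => i; rewrite !inE ffunE oppr_eq0. Qed.

Lemma conj_unity_root {C : numClosedFieldType} {k : nat} {x : C} :
  (0 < k)%N -> x ^+ k = 1 -> x^* = x^-1.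
Proof.
move=> k_gt0 xk1; have x1 : `|x| = 1.
  apply: (pexpIrn k_gt0); rewrite ?nnegrE ?normr_ge0 ?ler01 //.
  by rewrite -normrX xk1 normr1 expr1n.
by rewrite invC_norm x1 expr1n invr1 mul1r.
Qed.

Lemma monomial_opp {R : realType} {m : nat} {s : 'I_m -> nat} :
  (forall i, (0 < s i)%N) ->
  forall (a : exponents s) (z : design R s),
  (monomial R (opp_exponents a) z : R[i]) = (monomial R a z : R[i])^*.
Proof.
move=> s_gt0 a z; rewrite !ffunE rmorph_prod; apply: eq_bigr => i _.
have zi1 := levels_unity (s_gt0 i) (ssvalP (z i)).
rewrite rmorphXn /= (conj_unity_root (s_gt0 i) zi1) ffunE exprVn.
have zi_neq0 : ssval (z i) != 0.
  by apply: contra_eq_neq zi1 => ->; rewrite expr0n gtn_eqF // eq_sym oner_eq0.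
apply: (mulIf (expf_neq0 (a i) zi_neq0)); rewrite mulVf ?expf_neq0 // -exprD.
(* The canonical representatives of a i and - a i add up to 0 or to s i. *)
have dvd_s : (s i %| (- a i)%R + a i)%N.
  rewrite -{1}(prednK (s_gt0 i)) /dvdn.
  by have /(congr1 val)/= -> := addNr (a i).
by have /dvdnP[q ->] := dvd_s; rewrite mulnC exprM zi1 expr1n.
Qed.

(** The symmetry of the Fourier coefficients of a real-valued function: in the
    formula [coefE] only the monomials are affected by conjugation, and negating
    the exponent has the same effect on them. *)
Lemma coef_opp {R : realType} {m : nat} {s : 'I_m -> nat} :
  (forall i, (0 < s i)%N) ->
  forall (F : {mset design R s}) (a : exponents s),
  coef F (opp_exponents a) = (coef F a)^*.
Proof.
move=> s_gt0 F a; rewrite !coefE // rmorphM fmorphV rmorph_nat rmorph_sum.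
by congr (_ * _); apply: eq_bigr => g _; rewrite monomial_opp // fmorphV.
Qed.

(** Conjugation exchanges the terms of opposite exponents, which have the same
    weight; the Hermitian product of the weight-j coefficients is therefore
    real, although its terms need not be. *)
Lemma coef_product_real {R : realType} {m : nat} {s : 'I_m -> nat} :
  (forall i, (0 < s i)%N) ->
  forall (F G : {mset design R s}) (j : nat),
  \sum_(a : exponents s | wt0 a == j) (coef F a)^* * coef G a =
  \sum_(a : exponents s | wt0 a == j) coef F a * (coef G a)^*.
Proof.
move=> s_gt0 F G j.
rewrite (reindex_inj (inv_inj opp_exponentsK)) /=.
apply: eq_big => [a|a _]; first by rewrite wt0_opp.
by rewrite !coef_opp // conjCK.
Qed.

(** Trading the squared moduli for products with the conjugate makes the
    numerator a Hermitian form, which can be expanded. *)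
Lemma gwlpE {R : realType} {m : nat} {s : 'I_m -> nat}
    (F : {mset design R s}) (j : nat) :
  gwlp F j = (\sum_(a : exponents s | wt0 a == j) coef F a * (coef F a)^*)
             / coef F (exponent0 s) ^+ 2.
Proof.
by rewrite mulr_suml; apply: eq_bigr => a _; rewrite expr_div_n normCK.
Qed.

Theorem proposition3p5 (R : realType) (m : nat) (s : 'I_m -> nat)
    (s_gt0 : forall i, (0 < s i)%N)
    (n : nat) (F : {mset design R s}) (sizeF : size F = n) (n_ge2 : (2 <= n)%N)
    (f : design R s) (fF : f \in F) (j : nat) (j_le_m : (j <= m)%N) :
  gwlp F j =
    ((n%:R - 1) / n%:R) ^+ 2 * gwlp (F `\ f) j
    + 1 / n%:R ^+ 2 * gwlp [mset f] j
    + 2 * (#|{: design R s}|%:R) ^+ 2 / n%:R ^+ 2 *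
      \sum_(g <- F `\ f) \sum_(a : exponents s | wt0 a == j)
         coef [mset f] a * (coef [mset g] a)^*.
Proof.
have D_neq0 := card_design_neq0 R s_gt0.
set D : R[i] := _%:R in D_neq0 *.
have n_neq0 : n%:R != 0 :> R[i] by rewrite pnatr_eq0 -lt0n ltnW.
have n1_neq0 : n%:R - 1 != 0 :> R[i].
  by rewrite subr_eq0 pnatr_eq1 neq_ltn n_ge2 orbT.
have coefF a : coef F a = coef [mset f] a + coef (F `\ f) a.
  by rewrite -coefD msetB1K.
have c0f : coef [mset f] (exponent0 s) = 1 / D.
  rewrite coef_mset1 // ffunE big1 ?invr1 ?mulr1 ?mul1r // => i _.
  by rewrite ffunE.
have c0Ff : coef (F `\ f) (exponent0 s) = (n%:R - 1) / D.
  have := coefF (exponent0 s).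
  by rewrite coef_exponent0 // sizeF c0f -/D mulrBl => ->; rewrite addrC addKr.
rewrite !gwlpE c0f c0Ff coef_exponent0 // sizeF -/D.
have -> : \sum_(g <- F `\ f) \sum_(a : exponents s | wt0 a == j)
            coef [mset f] a * (coef [mset g] a)^*
        = \sum_(a : exponents s | wt0 a == j)
            coef [mset f] a * (coef (F `\ f) a)^*.
  rewrite exchange_big; apply: eq_bigr => a _.
  by rewrite (coef_sum s_gt0 (F `\ f)) rmorph_sum mulr_sumr.
set X := \sum_(a | _) coef [mset f] a * (coef (F `\ f) a)^*.
set P := \sum_(a | _) coef (F `\ f) a * (coef (F `\ f) a)^*.
set Q := \sum_(a | _) coef [mset f] a * (coef [mset f] a)^*.
have -> : \sum_(a | wt0 a == j) coef F a * (coef F a)^* = P + Q + X *+ 2.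
  have conjX := coef_product_real s_gt0 [mset f] (F `\ f) j.
  rewrite mulr2n -{1}[X]conjX -!big_split /=.
  by apply: eq_bigr => a _; rewrite coefF rmorphD /=; ring.
by field; rewrite D_neq0 n_neq0 n1_neq0.
Qed.
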